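(* Let $r,s,p\ge 0$ be integers and let $G$ be the graph with vertex set the disjoint union $A\cup B\cup X\cup W$, where $A=\{u_1,\dots,u_r\}$, $B=\{v_1,\dots,v_s\}$, $X=\{x_1,\dots,x_p\}$, $W=\{w_1,\dots,w_p\}$, and whose edges are exactly the following: all edges between distinct vertices of $A\cup B$ (so $A\cup B$ induces $K_{r+s}$); all edges between distinct vertices of $X$; all edges between distinct vertices of $W$; all edges $x_iu_j$ with $1\le i\le p$, $1\le j\le r$; and all edges $w_iv_j$ with $1\le i\le p$, $1\le j\le s$. If $|V(G)|\ge 4$, then $SC(G)=|V(G)|$.
   Context: Graphs are finite, simple and undirected, with nonempty vertex set $V(G)$; the order is $n=|V(G)|$. A set $D\subseteq V(G)$ is a strong dominating set of $G$ if for every $x\in V(G)\setminus D$ there is $y\in D$ with $xy\in E(G)$ and $\deg(x)\le\deg(y)$. Two disjoint sets $V_1,V_2\subseteq V(G)$ form a strong coalition if neither is a strong dominating set but $V_1\cup V_2$ is a strong dominating set. A strong coalition partition of $G$ is a partition $\Omega=\{V_1,\dots,V_k\}$ of $V(G)$ into nonempty sets such that each $V_i$ either is a strong dominating set consisting of a single vertex of degree $n-1$, or is not a strong dominating set but forms a strong coalition with another set $V_j\in\Omega$ that is not a strong dominating set. The strong coalition number $SC(G)$ is the maximum cardinality of a strong coalition partition of $G$, with $SC(G)=0$ if $G$ has no strong coalition partition. *)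

(* Defs.v *)
From mathcomp Require Import all_boot.

Set Implicit Arguments.
Unset Strict Implicit.
Unset Printing Implicit Defensive.

Record sgraph := SGraph {
  vertex :> finType;
  adj : rel vertex;
  adj_sym : symmetric adj;
  adj_irr : irreflexive adj }.

Definition deg (G : sgraph) (x : G) : nat := #|[set y | adj x y]|.

Definition strong_dominating (G : sgraph) (D : {set G}) : bool :=
  [forall x, (x \notin D) ==>
     [exists y, [&& y \in D, adj x y & deg x <= deg y]]].

Definition strong_coalition (G : sgraph) (V1 V2 : {set G}) : bool :=
  [&& [disjoint V1 & V2], ~~ strong_dominating V1,
      ~~ strong_dominating V2 & strong_dominating (V1 :|: V2)].

Definition strong_coalition_partition (G : sgraph) (P : {set {set G}}) : bool :=
  partition P [set: G] &&
  [forall V1 in P,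
     (strong_dominating V1 &&
        [exists x, (V1 == [set x]) && (deg x == #|G| - 1)])
     || [exists V2 in P, (V2 != V1) && strong_coalition V1 V2]].

(* The value is 0 when the range is empty, matching the convention that
   SC(G) = 0 if G has no strong coalition partition. *)
Definition SC (G : sgraph) : nat :=
  \max_(P : {set {set G}} | strong_coalition_partition P) #|P|.

Inductive block := BlockA | BlockB | BlockX | BlockW.

(* The summands are, in order, A, B, X, W. *)
Definition tc_vertex (r s p : nat) : finType := (('I_r + 'I_s) + ('I_p + 'I_p))%type.

Definition block_of (r s p : nat) (x : tc_vertex r s p) : block :=
  match x with
  | inl (inl _) => BlockA
  | inl (inr _) => BlockB
  | inr (inl _) => BlockX
  | inr (inr _) => BlockW
  end.

Definition block_adj (a b : block) : bool :=
  match a, b with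
  | BlockA, BlockA | BlockB, BlockB | BlockX, BlockX | BlockW, BlockW => true
  | BlockA, BlockB | BlockB, BlockA => true
  | BlockA, BlockX | BlockX, BlockA => true
  | BlockB, BlockW | BlockW, BlockB => true
  | BlockA, BlockW | BlockW, BlockA => false
  | BlockB, BlockX | BlockX, BlockB => false
  | BlockX, BlockW | BlockW, BlockX => false
  end.

Definition tc_adj (r s p : nat) : rel (tc_vertex r s p) :=
  fun x y => (x != y) && block_adj (block_of x) (block_of y).

Lemma tc_adj_sym (r s p : nat) : symmetric (@tc_adj r s p).
Proof.
by move=> x y; rewrite /tc_adj eq_sym; case: (block_of x) (block_of y) => [] [].
Qed.

Lemma tc_adj_irr (r s p : nat) : irreflexive (@tc_adj r s p).
Proof. by move=> x; rewrite /tc_adj eqxx. Qed.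

Definition tc_graph (r s p : nat) : sgraph :=
  SGraph (@tc_adj_sym r s p) (@tc_adj_irr r s p).

(* Main.v *)
Require Import Defs.
From mathcomp Require Import all_boot.
From mathcomp Require Import zify.

(** No partition of [G] into nonempty parts has more than [#|G|] parts, so it
is enough that the partition into singletons is a strong coalition partition
([SC_eq_card]): each vertex must either have full degree or form a strong
coalition with another vertex.

If [p = 0] the graph is complete and every vertex has full degree.  If
[p > 0], no single vertex dominates ([tc_not_strong_dominating1]): a vertex of
A or X has no neighbour in W, and one of B or W has none in X.  The sets A + X
and B + W are cliques covering the graph, so a pair with one vertex in each
dominates up to the condition on degrees.  The vertices of A and B have maximum
degree, and the degree is constant on each of the four blocks.

A vertex [y] of A + X is paired with a vertex [v] of B if there is one: [v]
covers A, B and W, and [y] covers X, where degrees are the smallest of its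
clique.  If B is empty, [y] is paired with a vertex of W: both cliques A + X
and W then have constant degree.  The vertices of B + W are treated
symmetrically. *)

Lemma card_partition_leq (T : finType) (P : {set {set T}}) (D : {set T}) :
  partition P D -> #|P| <= #|D|.
Proof.
move=> partP; rewrite (card_partition partP) -sum1_card.
apply: leq_sum => B PB; rewrite card_gt0; apply: contraTneq PB => ->.
by case/and3P: partP.
Qed.

Lemma partition_set1 (T : finType) :
  partition [set [set x] | x : T] [set: T].
Proof.
apply/and3P; split.
- rewrite /cover; apply/eqP/setP => x; rewrite inE.
  by apply/bigcupP; exists [set x]; rewrite ?imset_f ?set11.
- apply/trivIsetP => _ _ /imsetP[x _ ->] /imsetP[y _ ->] neq_xy.
  by rewrite disjoints1 inE; apply: contraNneq neq_xy => ->.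
- by apply/imsetP => -[x _ /setP/(_ x)]; rewrite !inE eqxx.
Qed.

Lemma neighbours_subD1 (G : sgraph) (x : G) :
  [set y | adj x y] \subset [set: G] :\ x.
Proof.
apply/subsetP => y; rewrite !inE andbT => xy.
by apply: contraTneq xy => ->; rewrite adj_irr.
Qed.

Lemma card_setTD1 (T : finType) (x : T) : #|[set: T] :\ x| = #|T| - 1.
Proof. by rewrite -cardsT (cardsD1 x [set: T]) inE add1n subn1. Qed.

Lemma deg_leq (G : sgraph) (x : G) : deg x <= #|G| - 1.
Proof. by rewrite -(card_setTD1 G x); exact/subset_leq_card/neighbours_subD1. Qed.

Lemma full_deg_strong_dominating (G : sgraph) (x : G) :
  deg x = #|G| - 1 -> strong_dominating [set x].
Proof.
move=> degx; apply/forallP => y; apply/implyP; rewrite inE => neq_yx.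
apply/existsP; exists x; rewrite inE eqxx /= degx deg_leq andbT adj_sym.
have /eqP eqN : [set z | adj x z] == [set: G] :\ x.
  by rewrite eqEcard neighbours_subD1 card_setTD1 -degx leqnn.
have : y \in [set: G] :\ x by rewrite !inE neq_yx.
by rewrite -eqN inE.
Qed.

Lemma SC_eq_card (G : sgraph) :
  (forall x : G, deg x = #|G| - 1 \/
     exists y : G, strong_coalition [set x] [set y]) ->
  SC G = #|G|.
Proof.
move=> coalG; apply/eqP; rewrite eqn_leq; apply/andP; split.
  by apply/bigmax_leqP => P /andP[/card_partition_leq]; rewrite cardsT.
rewrite -[X in X <= _](card_imset predT (@set1_inj G)).
apply: leq_bigmax_cond; rewrite /strong_coalition_partition partition_set1.
apply/forall_inP => _ /imsetP[x _ ->]; apply/orP.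
have [degx | [y coal_xy]] := coalG x; [left | right].
  rewrite full_deg_strong_dominating //=.
  by apply/existsP; exists x; rewrite degx !eqxx.
apply/exists_inP; exists [set y]; first exact: imset_f.
rewrite coal_xy andbT; case/andP: coal_xy => dis_xy _.
by apply: contraTneq dis_xy => ->; rewrite disjoints1 set11.
Qed.

(** The common degree of the vertices of a block; the predecessor accounts for
the vertex itself, which is counted in its own block. *)
Definition block_deg (r s p : nat) (b : block) : nat :=
  match b with
  | BlockA | BlockB => (r + s + p).-1
  | BlockX => (r + p).-1
  | BlockW => (s + p).-1
  end.

Lemma card_tc_graph (r s p : nat) : #|tc_graph r s p| = r + s + (p + p).
Proof. by rewrite /= /tc_vertex !card_sum !card_ord. Qed.

Lemma tc_degE (r s p : nat) (x : tc_graph r s p) :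
  deg x = block_deg r s p (block_of x).
Proof.
have -> : deg x = #|[set y : tc_vertex r s p |
                      block_adj (block_of x) (block_of y)]|.-1.
  rewrite (cardsD1 x) inE.
  have -> : block_adj (block_of x) (block_of x) by case: (block_of x).
  rewrite /deg /=; apply: eq_card => y.
  by rewrite !inE /= /tc_adj eq_sym.
rewrite -sum1_card (eq_bigl _ _ (fun y => in_set _ y)) !big_sumType /=.
case: x => [[i|i]|[i|i]] /=;
  rewrite ?big_pred0_eq ?sum1_card ?card_ord; lia.
Qed.

Lemma tc_strong_dominating2 (r s p : nat) (y z : tc_graph r s p) :
  (forall t : tc_graph r s p,
     block_adj (block_of t) (block_of y) && (deg t <= deg y) ||
     block_adj (block_of t) (block_of z) && (deg t <= deg z)) ->
  strong_dominating ([set y] :|: [set z]).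
Proof.
move=> dom; apply/forallP => t; apply/implyP; rewrite !inE negb_or.
case/andP=> neq_ty neq_tz; apply/existsP.
case/orP: (dom t) => /andP[bt dt]; [exists y | exists z];
  by rewrite !inE eqxx ?orbT dt andbT /= /tc_adj ?neq_ty ?neq_tz.
Qed.

Lemma tc_not_strong_dominating1 (r s p : nat) (x : tc_graph r s p) :
  0 < p -> ~~ strong_dominating [set x].
Proof.
move=> p_gt0.
have [t nxt] : exists t : tc_graph r s p,
    ~~ block_adj (block_of t) (block_of x).
  case: x => [[i|i]|[i|i]].
  - by exists (inr (inr (Ordinal p_gt0))).
  - by exists (inr (inl (Ordinal p_gt0))).
  - by exists (inr (inr (Ordinal p_gt0))).
  - by exists (inr (inl (Ordinal p_gt0))).
rewrite negb_forall; apply/existsP; exists t.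
rewrite negb_imply inE; apply/andP; split.
  by apply: contraNneq nxt => ->; case: (block_of x).
apply/existsP => -[y]; rewrite inE => /and3P[/eqP -> /=].
by rewrite /tc_adj (negPf nxt) andbF.
Qed.

Lemma tc_strong_coalition1 (r s p : nat) (y z : tc_graph r s p) :
  0 < p -> y != z -> strong_dominating ([set y] :|: [set z]) ->
  strong_coalition [set y] [set z].
Proof.
move=> p_gt0 neq_yz dom.
by rewrite /strong_coalition !tc_not_strong_dominating1 // dom disjoints1 inE neq_yz.
Qed.

Theorem theorem4p1 (r s p : nat) :
  4 <= #|tc_graph r s p| -> SC (tc_graph r s p) = #|tc_graph r s p|.
Proof.
move=> _; apply: SC_eq_card => x.
have [p0 | p_gt0] := posnP p.
  left; rewrite tc_degE card_tc_graph.
  (* The bound on [i] excludes X and W, which are empty. *)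
  case: x => [[i|i]|[i|i]] /=; have := ltn_ord i; lia.
right.
have [z [neq_xz dom]] : exists z : tc_graph r s p, x != z /\
    forall t : tc_graph r s p,
      block_adj (block_of t) (block_of x) && (deg t <= deg x) ||
      block_adj (block_of t) (block_of z) && (deg t <= deg z).
  (* A vertex of A or X is paired with B, or with W if B is empty; a vertex of
     B or W is paired with A, or with X if A is empty. *)
  case: x => [[i|i]|[i|i]];
    [ have [s0 | s_gt0] := posnP s;
        [exists (inr (inr (Ordinal p_gt0))) | exists (inl (inr (Ordinal s_gt0)))]
    | have [r0 | r_gt0] := posnP r;
        [exists (inr (inl (Ordinal p_gt0))) | exists (inl (inl (Ordinal r_gt0)))]
    | have [s0 | s_gt0] := posnP s;
        [exists (inr (inr (Ordinal p_gt0))) | exists (inl (inr (Ordinal s_gt0)))]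
    | have [r0 | r_gt0] := posnP r;
        [exists (inr (inl (Ordinal p_gt0))) | exists (inl (inl (Ordinal r_gt0)))] ];
  (* The bound on [j] discards the vertices [t] of an empty block. *)
  split=> // t; rewrite !tc_degE; case: t => [[j|j]|[j|j]] /=;
  have := ltn_ord j; lia.
exists z; apply: tc_strong_coalition1 => //; exact: tc_strong_dominating2.
Qed.
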